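(* Let $m,n,l$ be pairwise relatively prime positive integers, where $m=\prod_{i=1}^j p_i$ is a product of pairwise distinct primes $p_i\equiv 1 \pmod 6$, and $m^2=n^2+nl+l^2$. Let $k:=n+l$ and $A:=klmn$. Then the rank of the elliptic curve $C_A: y^2=x^3-A^2x$ over $\mathbb{Q}$ is at least two.
   Context: The rank of $C_A$ means the rank $r$ of the finitely generated abelian group $C_A(\mathbb{Q})$ of rational points of $C_A$ (together with the point at infinity), i.e. $C_A(\mathbb{Q})\cong T\times\mathbb{Z}^r$ with $T$ finite. *)

(* Defs.v *)
From HB Require Import structures.
From mathcomp Require Import all_boot all_order all_algebra.
From mathcomp Require Import ring.
Set Implicit Arguments.
Unset Strict Implicit.
Unset Printing Implicit Defensive.
Import GRing.Theory.
Local Open Scope ring_scope.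

(* Short Weierstrass curves y^2 = x^3 + a x + b. The factor 16 of the
   discriminant is kept so that characteristic 2 is excluded too. *)
Record ellCurve (F : fieldType) := EllCurve {
  ec_a : F;
  ec_b : F;
  ec_disc : - 16%:R * (4%:R * ec_a ^+ 3 + 27%:R * ec_b ^+ 2) != 0
}.

(* None is the point at infinity. *)
Definition on_curve (F : fieldType) (E : ellCurve F) (P : option (F * F)) :=
  if P is Some (x, y) then y ^+ 2 == x ^+ 3 + ec_a E * x + ec_b E else true.

Definition ec_opp (F : fieldType) (P : option (F * F)) : option (F * F) :=
  if P is Some (x, y) then Some (x, - y) else None.

Definition ec_slope (F : fieldType) (E : ellCurve F) (x1 y1 x2 y2 : F) : F :=
  if x1 == x2 then (3%:R * x1 ^+ 2 + ec_a E) / (2%:R * y1)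
  else (y2 - y1) / (x2 - x1).

Definition ec_add (F : fieldType) (E : ellCurve F) (P Q : option (F * F)) :
    option (F * F) :=
  match P, Q with
  | None, _ => Q
  | _, None => P
  | Some (x1, y1), Some (x2, y2) =>
      if (x1 == x2) && (y1 == - y2) then None
      else let s := ec_slope E x1 y1 x2 y2 in
           let x3 := s ^+ 2 - x1 - x2 in
           Some (x3, s * (x1 - x3) - y1)
  end.

(* This section shows that ec_add is an abelian group law. A
   slope s of the line through two points (the tangent if they coincide) is
   handled through the relation slope_of, which covers both cases at once. *)
Section GroupLaw.
Variables (F : fieldType) (E : ellCurve F).
Implicit Types (P Q R : option (F * F)) (x y s : F).
Local Notation a := (ec_a E).
Local Notation b := (ec_b E).
Local Notation add := (ec_add E).
Local Notation opp := (@ec_opp F).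
Local Notation onC := (on_curve E).

Definition slope_of x1 y1 x2 y2 s :=
  y2 - y1 = s * (x2 - x1) /\
  s * (y1 + y2) = x1 ^+ 2 + x1 * x2 + x2 ^+ 2 + a.

Definition sum_with x1 y1 x2 s : option (F * F) :=
  Some (s ^+ 2 - x1 - x2, s * (x1 - (s ^+ 2 - x1 - x2)) - y1).

Lemma ec_two_neq0 : 2%:R != 0 :> F.
Proof.
apply: contraNneq (ec_disc E) => h2.
by rewrite (natrM _ 2 8) h2 mul0r oppr0 mul0r.
Qed.

Lemma ec_nonsingular x : x ^+ 3 + a * x + b = 0 -> 3%:R * x ^+ 2 + a != 0.
Proof.
move=> h1; apply: contraNneq (ec_disc E) => h2.
have ea : a = - (3%:R * x ^+ 2) by rewrite -(addKr (3%:R * x ^+ 2) a) h2 addr0.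
have eb : b = 2%:R * x ^+ 3.
  have -> : b = x ^+ 3 + a * x + b - x ^+ 3 - a * x by ring.
  by rewrite h1 ea; ring.
by rewrite ea eb; apply/eqP; ring.
Qed.

Lemma ec_slope_uniq x1 y1 x2 y2 s t :
  slope_of x1 y1 x2 y2 s -> slope_of x1 y1 x2 y2 t ->
  ~~ ((x1 == x2) && (y1 == - y2)) -> s = t.
Proof.
case=> [s1 s2] [t1 t2]; case: eqVneq => [e|ne] /=.
  by rewrite -addr_eq0 => n0; apply: (mulIf n0); rewrite s2.
by move=> _; apply: (mulIf (_ : x2 - x1 != 0)); rewrite ?subr_eq0 1?eq_sym // -s1.
Qed.

Lemma ec_slopeP x1 y1 x2 y2 :
  onC (Some (x1, y1)) -> onC (Some (x2, y2)) ->
  ~~ ((x1 == x2) && (y1 == - y2)) ->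
  slope_of x1 y1 x2 y2 (ec_slope E x1 y1 x2 y2).
Proof.
move=> /eqP o1 /eqP o2; rewrite /ec_slope /slope_of; case: eqVneq => [e|ne] /=.
  move=> n0.
  have /eqP : (y1 - y2) * (y1 + y2) = 0.
    by rewrite -subr_sqr o1 o2 e subrr.
  rewrite mulf_eq0 subr_eq0 addr_eq0 (negPf n0) orbF => /eqP ey.
  rewrite -ey -e !subrr mulr0; split=> //.
  have y0 : y1 != 0 by apply: contraNneq n0 => h; rewrite -ey h oppr0.
  by field; rewrite ?y0 ?ec_two_neq0.
have n1 : x2 - x1 != 0 by rewrite subr_eq0 eq_sym.
move=> _; split; first by rewrite divfK.
apply: (mulIf n1); rewrite mulrAC divfK // [y1 + y2]addrC -subr_sqr o1 o2; ring.
Qed.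

Lemma ec_add_slope x1 y1 x2 y2 s :
  onC (Some (x1, y1)) -> onC (Some (x2, y2)) ->
  ~~ ((x1 == x2) && (y1 == - y2)) -> slope_of x1 y1 x2 y2 s ->
  add (Some (x1, y1)) (Some (x2, y2)) = sum_with x1 y1 x2 s.
Proof.
move=> o1 o2 n0 hs; rewrite /= (negPf n0).
by rewrite (ec_slope_uniq (ec_slopeP o1 o2 n0) hs n0).
Qed.

Lemma add_spec x1 y1 x2 y2 :
  onC (Some (x1, y1)) -> onC (Some (x2, y2)) ->
  [/\ x1 = x2, y1 = - y2 & add (Some (x1, y1)) (Some (x2, y2)) = None] \/
  exists s, [/\ slope_of x1 y1 x2 y2 s, ~~ ((x1 == x2) && (y1 == - y2)) &
    add (Some (x1, y1)) (Some (x2, y2)) = sum_with x1 y1 x2 s].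
Proof.
move=> o1 o2; case: (boolP ((x1 == x2) && (y1 == - y2))) => [h|h].
  by left; case/andP: (h) => /eqP e1 /eqP e2; split=> //; rewrite /= h.
right; exists (ec_slope E x1 y1 x2 y2); split=> //; first exact: ec_slopeP.
by apply: ec_add_slope => //; apply: ec_slopeP.
Qed.

Lemma slope_a x1 y1 x2 y2 s : slope_of x1 y1 x2 y2 s ->
  y1 = y2 + s * (x1 - x2) /\
  a = s * (2%:R * y2 + s * (x1 - x2)) - (x1 ^+ 2 + x1 * x2 + x2 ^+ 2).
Proof.
case=> [h1 h2].
have ey : y1 = y2 + s * (x1 - x2).
  by rewrite -[y1](subKr y2) h1; ring.
split=> //; rewrite -[a](addKr (x1 ^+ 2 + x1 * x2 + x2 ^+ 2)) -h2 ey; ring.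
Qed.

Lemma on_curve_opp P : onC (opp P) = onC P.
Proof. by case: P => [[x y]|] //=; rewrite sqrrN. Qed.

Lemma on_curve_add P Q : onC P -> onC Q -> onC (add P Q).
Proof.
case: P => [[x1 y1]|] // o1; case: Q => [[x2 y2]|] // o2.
case: (add_spec o1 o2) => [[_ _ ->] //|[s [hs _ ->]]].
have [e1 ea] := slope_a hs.
have eb : b = y2 ^+ 2 - x2 ^+ 3 - a * x2 by rewrite (eqP o2); ring.
by apply/eqP; rewrite eb ea e1; ring.
Qed.

Lemma ec_addC P Q : onC P -> onC Q -> add P Q = add Q P.
Proof.
case: P => [[x1 y1]|]; case: Q => [[x2 y2]|] // o1 o2.
case: (add_spec o1 o2) => [[e1 e2 ->]|[s [[h1 h2] n0 ->]]].
  by rewrite /= e1 e2 opprK !eqxx.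
have hs : slope_of x2 y2 x1 y1 s.
  by split; [rewrite -(opprB y2) h1; ring | rewrite addrC h2; ring].
rewrite (ec_add_slope o2 o1 _ hs).
  have [e1 _] := slope_a (conj h1 h2).
  by rewrite /sum_with e1; congr (Some (_, _)); ring.
by rewrite eq_sym [y2 == _]eq_sym eqr_oppLR.
Qed.

Lemma ec_oppK P : opp (opp P) = P.
Proof. by case: P => [[x y]|] //=; rewrite opprK. Qed.

Lemma ec_addNr P : add P (opp P) = None.
Proof. by case: P => [[x y]|] //=; rewrite opprK !eqxx. Qed.

Lemma ec_addr0 P : add P None = P.
Proof. by case: P => [[]|]. Qed.

Lemma ec_addK P Q : onC P -> onC Q -> add (add P Q) (opp Q) = P.
Proof.
case: Q => [[x2 y2]|]; last by rewrite !ec_addr0.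
case: P => [[x1 y1]|] o1 o2; last exact: ec_addNr.
case: (add_spec o1 o2) => [[-> -> ->] //|[s [hs n0 e]]].
have o3 := on_curve_add o1 o2; rewrite e /sum_with in o3 *.
have o2' : onC (Some (x2, - y2)) by rewrite -(on_curve_opp (Some (x2, y2))) in o2.
have [e1 ea] := slope_a hs.
move: o3; move ex3 : (s ^+ 2 - x1 - x2) => x3 o3.
have hs' : slope_of x3 (s * (x1 - x3) - y1) x2 (- y2) (- s).
  by split; rewrite ?ea e1 -ex3; ring.
rewrite (ec_add_slope o3 o2' _ hs').
  by rewrite /sum_with e1 -ex3; congr (Some (_, _)); ring.
rewrite opprK; apply/negP => /andP[/eqP ex /eqP ey].
have y0 : y2 = 0.
  have : 2%:R * y2 = 0.
    have -> : 2%:R * y2 = y2 - (s * (x1 - x3) - y1) - s * (x3 - x2).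
      by rewrite e1; ring.
    by rewrite ey ex; ring.
  by move/eqP; rewrite mulf_eq0 (negPf ec_two_neq0) => /eqP.
have /ec_nonsingular/eqP[] : x2 ^+ 3 + a * x2 + b = 0.
  by rewrite -(eqP o2) y0 expr0n.
have ex1 : s ^+ 2 = x1 + 2%:R * x2.
  have -> : s ^+ 2 = x3 + x1 + x2 by rewrite -ex3; ring.
  by rewrite ex; ring.
by rewrite ea y0; transitivity (s ^+ 2 * (x1 - x2) - (x1 - x2) * (x1 + 2%:R * x2));
  [ring | rewrite ex1; ring].
Qed.

Lemma slopes_solve (u1 us u3 ut la mu w : F) : la != mu ->
  la ^+ 2 - u1 - us = mu ^+ 2 - u3 - ut ->
  u1 * us + w * la = u3 * ut + w * mu ->
  ut = mu ^+ 2 - u3 - (la ^+ 2 - u1 - us) /\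
  w = (u3 * ut - u1 * us) / (la - mu).
Proof.
rewrite -subr_eq0 => n1 eut ew; split; first by rewrite eut; ring.
by apply: (mulIf n1); rewrite divfK // mulrBr -(addKr (u1 * us) (w * la)) ew; ring.
Qed.

(* In the next three lemmas the x-coordinates are taken relative to that of
   the middle point Q, w is twice the y-coordinate of Q, and u1, us, u3, ut are
   those of P, P + Q, R, Q + R; la, mu, nu, rho are the slopes for (P, Q),
   (Q, R), (P + Q, R) and (P, Q + R). *)
Lemma assoc_generic (u1 us u3 ut la mu w nu rho : F) :
  la != mu -> us != u3 -> ut != u1 ->
  la ^+ 2 - u1 - us = mu ^+ 2 - u3 - ut ->
  u1 * us + w * la = u3 * ut + w * mu ->
  nu * (us - u3) = - (w + la * us + mu * u3) ->
  rho * (ut - u1) = - (w + mu * ut + la * u1) ->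
  let uf := nu ^+ 2 - us - u3 - (la ^+ 2 - u1 - us) in
  nu ^+ 2 - us - u3 = rho ^+ 2 - u1 - ut /\
  nu * (u3 - uf) - mu * u3 = rho * (u1 - uf) - la * u1.
Proof.
move=> n1; rewrite -(subr_eq0 us) -(subr_eq0 ut) => n2 n3 eut ew enu erho uf.
have [eut' ew'] := slopes_solve n1 eut ew; rewrite -subr_eq0 in n1.
have enu' : nu = - (w + la * us + mu * u3) / (us - u3).
  by apply: (mulIf n2); rewrite divfK.
have erho' : rho = - (w + mu * ut + la * u1) / (ut - u1).
  by apply: (mulIf n3); rewrite divfK.
have n3' : mu ^+ 2 - u3 - (la ^+ 2 - u1 - us) - u1 != 0 by rewrite -eut'.
by rewrite /uf enu' erho' ew' eut'; split; field; rewrite ?n1 ?n2 ?n3'.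
Qed.

Lemma assoc_tangent (u1 us u3 ut la mu w nu rho : F) :
  la != mu -> us = u3 -> ut != u1 -> mu * u3 - la * us != 0 ->
  la ^+ 2 - u1 - us = mu ^+ 2 - u3 - ut ->
  u1 * us + w * la = u3 * ut + w * mu ->
  nu * (us - u3) = - (w + la * us + mu * u3) ->
  nu * (mu * u3 - la * us) = us ^+ 2 + us * u3 + u3 ^+ 2
     + (la ^+ 2 - u1 - us) * (us + u3) + (u1 * us + w * la) ->
  rho * (ut - u1) = - (w + mu * ut + la * u1) ->
  let uf := nu ^+ 2 - us - u3 - (la ^+ 2 - u1 - us) in
  nu ^+ 2 - us - u3 = rho ^+ 2 - u1 - ut /\
  nu * (u3 - uf) - mu * u3 = rho * (u1 - uf) - la * u1.
Proof.
move=> n1 e3; rewrite -e3 -(subr_eq0 ut) => n3; rewrite -mulrBl mulf_eq0 negb_or.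
case/andP=> n1' us0 eut _ ew enu erho uf.
have eut' : ut = mu ^+ 2 - us - (la ^+ 2 - u1 - us) by rewrite eut; ring.
have ew' : w = - (la + mu) * us.
  have -> : w = w + la * us + mu * us - (la + mu) * us by ring.
  by rewrite -[X in X - _]opprK -ew subrr mulr0 oppr0 add0r mulNr.
have enu' : nu = (us ^+ 2 + us * us + us ^+ 2
     + (la ^+ 2 - u1 - us) * (us + us) + (u1 * us + w * la)) / ((mu - la) * us).
  by apply: (mulIf (mulf_neq0 n1' us0)); rewrite divfK ?mulf_neq0.
have erho' : rho = - (w + mu * ut + la * u1) / (ut - u1).
  by apply: (mulIf n3); rewrite divfK.
have eut1 : ut - u1 = (mu - la) * (mu + la) by rewrite eut'; ring.
have : mu + la != 0 by apply: contraNneq n3 => h; rewrite eut1 h mulr0.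
move=> n4; rewrite eut1 in erho'.
by rewrite /uf enu' erho' ew' eut'; split; field; rewrite ?n1' ?us0 ?n4.
Qed.

Lemma assoc_tangents (u1 us u3 ut la mu w nu rho : F) :
  la != mu -> us = u3 -> ut = u1 ->
  mu * u3 - la * us != 0 -> la * u1 - mu * ut != 0 ->
  la ^+ 2 - u1 - us = mu ^+ 2 - u3 - ut ->
  nu * (us - u3) = - (w + la * us + mu * u3) ->
  nu * (mu * u3 - la * us) = us ^+ 2 + us * u3 + u3 ^+ 2
     + (la ^+ 2 - u1 - us) * (us + u3) + (u1 * us + w * la) ->
  rho * (la * u1 - mu * ut) = ut ^+ 2 + ut * u1 + u1 ^+ 2
     + (la ^+ 2 - u1 - us) * (ut + u1) + (u1 * us + w * la) ->
  let uf := nu ^+ 2 - us - u3 - (la ^+ 2 - u1 - us) in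
  nu ^+ 2 - us - u3 = rho ^+ 2 - u1 - ut /\
  nu * (u3 - uf) - mu * u3 = rho * (u1 - uf) - la * u1.
Proof.
move=> n1 e3 e1; rewrite -e3 e1 -!mulrBl !mulf_eq0 !negb_or.
case/andP=> _ us0 /andP[_ u10] eut ew enu erho uf.
have emu : mu = - la.
  have : (la - mu) * (la + mu) = 0.
    rewrite -subr_sqr.
    have -> : la ^+ 2 = la ^+ 2 - u1 - us + u1 + us by ring.
    by rewrite eut; ring.
  move/eqP; rewrite mulf_eq0 subr_eq0 (negPf n1) /= addrC addr_eq0.
  by move/eqP.
have la0 : la != 0 by apply: contraNneq n1 => h; rewrite emu h oppr0.
have ew' : w = 0.
  have -> : w = w + la * us + mu * us by rewrite emu; ring.
  by rewrite -[LHS]opprK -ew subrr mulr0 oppr0.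
have n2 := ec_two_neq0.
have n3 : mu - la != 0 by rewrite subr_eq0 eq_sym.
have enu' : nu = (us ^+ 2 + us * us + us ^+ 2
     + (la ^+ 2 - u1 - us) * (us + us) + (u1 * us + w * la)) / ((mu - la) * us).
  by apply: (mulIf (mulf_neq0 n3 us0)); rewrite divfK ?mulf_neq0.
have n4 : la - mu != 0 by rewrite subr_eq0.
have erho' : rho = (u1 ^+ 2 + u1 * u1 + u1 ^+ 2
     + (la ^+ 2 - u1 - us) * (u1 + u1) + (u1 * us + w * la)) / ((la - mu) * u1).
  by apply: (mulIf (mulf_neq0 n4 u10)); rewrite divfK ?mulf_neq0.
have em : mu - la = - (2%:R * la) by rewrite emu; ring.
have em' : la - mu = 2%:R * la by rewrite emu; ring.
rewrite em in enu'; rewrite em' in erho'.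
by rewrite /uf enu' erho' ew' emu; split; field; rewrite ?oppr_eq0 ?mulf_neq0 ?us0 ?u10 ?n2 ?la0.
Qed.

Lemma ec_oppD P Q : onC P -> onC Q -> opp (add P Q) = add (opp P) (opp Q).
Proof.
case: P => [[x1 y1]|]; case: Q => [[x2 y2]|] // o1 o2.
have o1' : onC (opp (Some (x1, y1))) by rewrite on_curve_opp.
have o2' : onC (opp (Some (x2, y2))) by rewrite on_curve_opp.
case: (add_spec o1 o2) => [[e1 e2 ->]|[s [[h1 h2] n0 ->]]].
  by rewrite /= e1 e2 opprK !eqxx.
rewrite (ec_add_slope o1' o2' _ (_ : slope_of _ _ _ _ (- s))).
- by rewrite /sum_with /=; congr (Some (_, _)); ring.
- by rewrite eqr_opp.
by split; [rewrite mulNr -h1; ring | rewrite -h2; ring].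
Qed.

Lemma add_third P Q : onC P -> onC Q -> add Q (opp (add P Q)) = opp P.
Proof.
move=> o1 o2; have oA := on_curve_add o1 o2.
have oN R : onC R -> onC (opp R) by rewrite on_curve_opp.
rewrite -[in RHS](ec_addK o1 o2) [RHS]ec_oppD ?oN // ec_oppK.
by rewrite ec_addC ?oN.
Qed.

Lemma ec_addA P Q R : onC P -> onC Q -> onC R ->
  add P (add Q R) = add (add P Q) R.
Proof.
move=> oP oQ oR; have oN S : onC S -> onC (opp S) by rewrite on_curve_opp.
have oPQ := on_curve_add oP oQ; have oQR := on_curve_add oQ oR.
have third1 : R = opp (add P Q) -> add P (add Q R) = add (add P Q) R.
  by move=> ->; rewrite add_third // !ec_addNr.
have third2 : P = opp (add Q R) -> add P (add Q R) = add (add P Q) R.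
  move=> eP; rewrite (ec_addC oP oQ) eP [add Q R]ec_addC // add_third //.
  by rewrite [LHS]ec_addC ?oN ?on_curve_add // [RHS]ec_addC ?oN // !ec_addNr.
case: P oP oPQ third1 third2 => [[x1 y1]|] // oP oPQ third1 third2.
case: Q oQ oPQ oQR third1 third2 => [[x2 y2]|] // oQ oPQ oQR third1 third2.
case: R oR oQR third1 third2 => [[x3 y3]|] // oR oQR third1 third2; last first.
  by rewrite !ec_addr0.
case: (add_spec oP oQ) => [[e1 e2 e]|[la [hla n0 ela]]].
  rewrite e e1 e2 -[Some (x2, - y2)]/(opp (Some (x2, y2))).
  by rewrite [add _ (Some (x3, _))]ec_addC // ec_addC ?oN ?on_curve_add // ec_addK.
case: (add_spec oQ oR) => [[e1 e2 e]|[mu [hmu n0' emu]]].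
  rewrite e ec_addr0; have -> : Some (x3, y3) = opp (Some (x2, y2)).
    by rewrite /= e1 e2 opprK.
  by rewrite ec_addK.
have [ey1 ea1] := slope_a hla.
have [ey3' ea3'] := slope_a hmu.
have ey3 : y3 = y2 + mu * (x3 - x2) by rewrite ey3'; ring.
have ea3 : a = mu * (2%:R * y2 + mu * (x3 - x2)) - (x2 ^+ 2 + x2 * x3 + x3 ^+ 2).
  by rewrite [LHS]ea3' ey3; ring.
move: oPQ oQR third1 third2; rewrite ela emu /sum_with.
move exs : (la ^+ 2 - x1 - x2) => xs; move ext : (mu ^+ 2 - x2 - x3) => xt.
move eys : (la * (x1 - xs) - y1) => ys; move eyt : (mu * (x2 - xt) - y2) => yt.
move=> oPQ oQR third1 third2.
have rel1 : la ^+ 2 - (x1 - x2) - (xs - x2) = mu ^+ 2 - (x3 - x2) - (xt - x2).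
  by rewrite -exs -ext; ring.
have rel2a : (x1 - x2) * (xs - x2) + 2%:R * y2 * la = 3%:R * x2 ^+ 2 + a.
  by rewrite ea1 -exs; ring.
have rel2b : (x3 - x2) * (xt - x2) + 2%:R * y2 * mu = 3%:R * x2 ^+ 2 + a.
  by rewrite ea3 -ext; ring.
case: (eqVneq la mu) => [elm|nlm].
  have : (x3 - x1) * (x3 - xs) = 0.
    have -> : (x3 - x1) * (x3 - xs) = ((x1 - x2) * (xs - x2) + 2%:R * y2 * la)
       - 2%:R * y2 * la + (x3 - x2) * ((la ^+ 2 - (x1 - x2) - (xs - x2))
         - la ^+ 2 + (x3 - x2)) by ring.
    by rewrite rel2a -rel2b rel1 elm; ring.
  move/eqP; rewrite mulf_eq0 !subr_eq0 => /orP[]/eqP ex.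
    have ey : y3 = y1 by rewrite ey3 ey1 ex elm.
    have eR : Some (x3, y3) = Some (x1, y1) by rewrite ex ey.
    rewrite eR [RHS]ec_addC //; congr (add _ _).
    rewrite -(_ : add (Some (x2, y2)) (Some (x3, y3)) = Some (xt, yt)); last first.
      by rewrite emu /sum_with ext eyt.
    rewrite eR ec_addC // ela /sum_with exs eys //.
  apply: third1; rewrite /= -ex; congr (Some (_, _)).
  by rewrite -eys ey1 ey3 -ex elm; ring.
case: (add_spec oPQ oR) => [[e1 e2 _]|[nu [hnu n1 enu]]].
  by apply: third1; rewrite /= e1 e2 opprK.
case: (add_spec oP oQR) => [[e1 e2 _]|[rho [hrho n2 erho]]].
  by apply: third2; rewrite /= e1 e2.
rewrite enu erho.
set uf := nu ^+ 2 - (xs - x2) - (x3 - x2)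
           - (la ^+ 2 - (x1 - x2) - (xs - x2)).
suff [h1 h2] :
   nu ^+ 2 - (xs - x2) - (x3 - x2) = rho ^+ 2 - (x1 - x2) - (xt - x2) /\
   nu * ((x3 - x2) - uf) - mu * (x3 - x2) = rho * ((x1 - x2) - uf) - la * (x1 - x2).
  have ex : rho ^+ 2 - x1 - xt = nu ^+ 2 - xs - x3.
    transitivity (rho ^+ 2 - (x1 - x2) - (xt - x2) - 2%:R * x2); first by ring.
    by rewrite -h1; ring.
  have euf : nu ^+ 2 - xs - x3 = uf + x2 by rewrite /uf -exs; ring.
  rewrite /sum_with ex euf; congr (Some (_, _)).
  transitivity (rho * (x1 - x2 - uf) - la * (x1 - x2) - y2); first by rewrite ey1; ring.
  rewrite -h2.
  have [eys' _] := slope_a hnu.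
  by rewrite eys' ey3; ring.
have rel2 := etrans rel2a (esym rel2b).
have nu1 : nu * ((xs - x2) - (x3 - x2)) =
   - (2%:R * y2 + la * (xs - x2) + mu * (x3 - x2)).
  transitivity (- (y3 - ys)); first by rewrite (hnu.1); ring.
  by rewrite ey3 -eys ey1; ring.
have rho1 : rho * ((xt - x2) - (x1 - x2)) =
   - (2%:R * y2 + mu * (xt - x2) + la * (x1 - x2)).
  transitivity (yt - y1); first by rewrite (hrho.1); ring.
  by rewrite -eyt ey1; ring.
have nu2 : nu * (mu * (x3 - x2) - la * (xs - x2)) =
   (xs - x2) ^+ 2 + (xs - x2) * (x3 - x2) + (x3 - x2) ^+ 2
     + (la ^+ 2 - (x1 - x2) - (xs - x2)) * ((xs - x2) + (x3 - x2))
     + ((x1 - x2) * (xs - x2) + 2%:R * y2 * la).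
  transitivity (nu * (ys + y3)); first by rewrite -eys ey3 ey1; ring.
  by rewrite (hnu.2) rel2a -exs; ring.
have rho2 : rho * (la * (x1 - x2) - mu * (xt - x2)) =
   (xt - x2) ^+ 2 + (xt - x2) * (x1 - x2) + (x1 - x2) ^+ 2
     + (la ^+ 2 - (x1 - x2) - (xs - x2)) * ((xt - x2) + (x1 - x2))
     + ((x1 - x2) * (xs - x2) + 2%:R * y2 * la).
  transitivity (rho * (y1 + yt)); first by rewrite -eyt ey1; ring.
  by rewrite (hrho.2) rel2a -exs; ring.
have d1 : xs = x3 -> mu * (x3 - x2) - la * (xs - x2) != 0.
  move=> e; move: n1; rewrite e eqxx /= -addr_eq0; apply: contraNneq => h.
  by rewrite -h -eys ey3 ey1 e; apply/eqP; ring.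
have d2 : xt = x1 -> la * (x1 - x2) - mu * (xt - x2) != 0.
  move=> e; move: n2; rewrite e eqxx /= -addr_eq0; apply: contraNneq => h.
  by rewrite -h -eyt ey1 e; apply/eqP; ring.
have sI (z t : F) : z - x2 = t - x2 -> z = t by move/addIr.
case: (eqVneq (xs - x2) (x3 - x2)) => e1; case: (eqVneq (xt - x2) (x1 - x2)) => e2.
- exact: (assoc_tangents nlm e1 e2 (d1 (sI _ _ e1)) (d2 (sI _ _ e2)) rel1 nu1 nu2 rho2).
- exact: (assoc_tangent nlm e1 e2 (d1 (sI _ _ e1)) rel1 rel2 nu1 nu2 rho1).
- rewrite eq_sym in nlm; rewrite rel2 in rho2; rewrite rel1 in rho2.
  have [h1 h2] := assoc_tangent nlm e2 e1 (d2 (sI _ _ e2)) (esym rel1) (esym rel2)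
    rho1 rho2 nu1.
  by rewrite /uf rel1 [nu ^+ 2 - _ - _]addrAC -h1; split; [ring | exact/esym].
- exact: (assoc_generic nlm e1 e2 rel1 rel2 nu1 rho1).
Qed.

End GroupLaw.

Record ec_point (F : fieldType) (E : ellCurve F) := EcPoint {
  ec_coord :> option (F * F);
  ec_coordP : on_curve E ec_coord
}.

HB.instance Definition _ (F : fieldType) (E : ellCurve F) :=
  [isSub for @ec_coord F E].
HB.instance Definition _ (F : fieldType) (E : ellCurve F) :=
  [Choice of ec_point E by <:].

Section PointGroup.
Variables (F : fieldType) (E : ellCurve F).

Definition ecp_zero : ec_point E := EcPoint (isT : on_curve E None).
Definition ecp_opp (P : ec_point E) : ec_point E :=
  EcPoint (etrans (on_curve_opp E P) (ec_coordP P)).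
Definition ecp_add (P Q : ec_point E) : ec_point E :=
  EcPoint (on_curve_add (ec_coordP P) (ec_coordP Q)).

Lemma ecp_addA : associative ecp_add.
Proof. by move=> P Q R; apply: val_inj; apply: ec_addA; apply: ec_coordP. Qed.

Lemma ecp_addC : commutative ecp_add.
Proof. by move=> P Q; apply: val_inj; apply: ec_addC; apply: ec_coordP. Qed.

Lemma ecp_add0 : left_id ecp_zero ecp_add.
Proof. by move=> P; apply: val_inj. Qed.

Lemma ecp_addN : left_inverse ecp_zero ecp_opp ecp_add.
Proof.
by move=> P; rewrite ecp_addC; apply: val_inj; apply: ec_addNr.
Qed.

HB.instance Definition _ :=
  GRing.isZmodule.Build (ec_point E) ecp_addA ecp_addC ecp_add0 ecp_addN.

End PointGroup.

Lemma congruent_disc (A : nat) : (0 < A)%N ->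
  - 16%:R * (4%:R * (- A%:R ^+ 2) ^+ 3 + 27%:R * 0 ^+ 2) != 0 :> rat.
Proof.
move=> A_gt0; rewrite expr0n mulr0 addr0.
by rewrite !(mulf_eq0, oppr_eq0, expf_eq0) /= !Num.Theory.pnatr_eq0 (gtn_eqF A_gt0).
Qed.

(* The curve C_A : y^2 = x^3 - A^2 x over the rationals. *)
Definition congruent_curve (A : nat) (A_gt0 : (0 < A)%N) : ellCurve rat :=
  @EllCurve rat (- A%:R ^+ 2) 0 (congruent_disc A_gt0).
Arguments congruent_curve A A_gt0 : clear implicits.

(* G is isomorphic to T x Z^r with T finite. *)
Definition has_rank (G : zmodType) (r : nat) : Prop :=
  exists (T : finZmodType) (f : {additive G -> T * 'rV[int]_r}), bijective f.

Lemma klmn_gt0 (m n l : nat) :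
  (0 < m)%N -> (0 < n)%N -> (0 < l)%N -> (0 < (n + l) * l * m * n)%N.
Proof. by move=> m0 n0 l0; rewrite !muln_gt0 addn_gt0 m0 n0 l0. Qed.

(* Main.v *)
(** If [A = u v (u^2 - v^2)], the right triangle with legs [u^2 - v^2] and [2 u v]
    gives the point with [x = u^2 (u^2 - v^2)] on [C_A].  Since
    [m^2 - n^2 = k l], [m^2 - l^2 = k n] and [k^2 - m^2 = n l], the pairs
    [(m, n)], [(m, l)], [(k, m)] give three such points; they lie on a line of
    slope [k^2], hence sum to zero.  [C_A] has no rational point of order 4, so
    if the rank were at most one, some one of these three points would be a
    double [2 R] up to a 2-torsion point.  As [x], [x - A], [x + A] are squares at a
    double, this makes either [u (u + v)] and [u (u - v)] or [u v] a square,
    so by coprimality [m] is a square, against squarefreeness, or [k - m],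
    [k], [k + m] are all squares with [m] odd, impossible modulo 4. *)
Require Import Defs.
From mathcomp Require Import all_boot all_order all_algebra.
From mathcomp Require Import fingroup ring lra zify.

Import Order.TTheory GRing.Theory Num.Theory.

(** * Squares among natural numbers *)

Lemma coprime_mul_square (a b s : nat) :
  coprime a b -> a * b = s ^ 2 -> exists t, a = t ^ 2.
Proof.
case: (posnP a) => [-> _ _|a_gt0 co_ab def_ab]; first by exists 0.
(* Writing [a = a' d] and [s = s' d] turns [a b = s^2] into [a' b = d s'^2]. As [a'] is coprime to
   [s'] and [d] to [b], [a'] and [d] divide each other, so [a = d^2]. *)
set d := gcdn a s; have d_gt0 : 0 < d by rewrite gcdn_gt0 a_gt0.
have [a' def_a] := dvdnP (dvdn_gcdl a s : d %| a).
have [s' def_s] := dvdnP (dvdn_gcdr a s : d %| s).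
have co_as : coprime a' s'.
  rewrite /coprime -(eqn_pmul2r d_gt0) mul1n muln_gcdl -def_a -def_s.
  by rewrite -/d.
have e : a' * b = d * s' ^ 2.
  apply/eqP; rewrite -(eqn_pmul2r d_gt0); apply/eqP; nia.
have a'd : a' %| d.
  by rewrite -(Gauss_dvdl d (coprimeXr 2 co_as)) -e dvdn_mulr.
have da' : d %| a'.
  have co_db : coprime d b by apply: coprime_dvdl co_ab; apply: dvdn_gcdl.
  by rewrite -(Gauss_dvdl a' co_db) e dvdn_mulr.
have e' : a' = d by apply/eqP; rewrite eqn_dvd a'd da'.
by exists d; rewrite {1}def_a e' mulnn.
Qed.

Lemma natr_rat_square (N : nat) (q : rat) :
  (N%:R = q ^+ 2)%R -> exists s, N = s ^ 2.
Proof.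
move=> e; exists `|numq q|%N.
have co := coprime_num_den q.
have e2 : (N%:Z * denq q ^+ 2 = numq q ^+ 2)%R.
  apply: (@intr_inj rat); rewrite rmorphM !rmorphXn /= -pmulrn e.
  by rewrite -exprMn -{1}(divq_num_den q) divfK // intr_eq0 denq_neq0.
have e3 : N * `|denq q| ^ 2 = `|numq q| ^ 2.
  by move/(congr1 absz): e2; rewrite abszM !abszX.
have : `|denq q| ^ 2 %| `|numq q| ^ 2 by rewrite -e3 dvdn_mull.
rewrite dvdn_pexp2r // => /gcdn_idPr; rewrite (eqP co) => e1.
by rewrite -e3 -e1 muln1.
Qed.

(** * Abelian groups modulo doubling *)

Section Abelian.
Local Open Scope ring_scope.

Lemma finZmod_torsion (T : finZmodType) (x : T) :
  exists2 N, (0 < N)%N & x *+ N = 0.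
Proof.
by exists #[x]%g; rewrite ?order_gt0 // -FinRing.zmodXgE expg_order.
Qed.

(** Strong induction on [N]: for [N] odd, [x] itself is a double; for [N = 2] modulo 4, the
    2-torsion term is [(N/2) x]; for [4 | N], the absence of order 4 already gives [(N/2) x = 0]. *)
Lemma torsion_mod_double (G : zmodType) :
  (forall t : G, t *+ 2 *+ 2 = 0 -> t *+ 2 = 0) ->
  forall (x : G) N, (0 < N)%N -> x *+ N = 0 ->
  exists y t, x = y *+ 2 + t /\ t *+ 2 = 0.
Proof.
move=> no4 x N; elim/ltn_ind: N => N IH N_gt0 xN.
have eN := odd_double_half N; case oN : (odd N) in eN.
  exists (- (x *+ N./2)), 0; rewrite mul0rn addr0; split=> //.
  by apply/eqP; rewrite mulNrn -addr_eq0 -mulrnA muln2 -mulrS -add1n eN xN.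
case: (posnP N./2) => [h|h]; first by move: N_gt0; rewrite -eN h.
have eN4 := odd_double_half N./2; case oN2 : (odd N./2) in eN4.
  exists (- (x *+ N./2./2)), (x *+ N./2); split; last first.
    by rewrite -mulrnA muln2 -xN -[in RHS]eN.
  by rewrite mulNrn -mulrnA muln2 -{2}eN4 mulrnDr addrC addrK.
have ltN : (N./2 < N)%N by lia.
apply: (IH _ ltN h).
rewrite -eN4 add0n -muln2 mulrnA; apply: no4; rewrite -!mulrnA.
by rewrite -[RHS]xN; congr (x *+ _); lia.
Qed.

(** Modulo doubles and torsion, a group of rank at most one has at most two classes, so one of [P1],
    [P2], [P1 + P2] falls in the trivial one. *)
Lemma rank_lt2_dependent (G : zmodType) (r : nat) :
  has_rank G r -> (r < 2)%N ->
  (forall t : G, t *+ 2 *+ 2 = 0 -> t *+ 2 = 0) ->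
  forall P1 P2 : G, exists P R t,
    [/\ [\/ P = P1, P = P2 | P = P1 + P2], t *+ 2 = 0 & P + t = R *+ 2].
Proof.
case=> T [f [g fK gK]] r2 no4 P1 P2.
suff [P [v [hP hv]]] : exists P v,
    [\/ P = P1, P = P2 | P = P1 + P2] /\ (f P).2 = v *+ 2.
  have [N N_gt0 tN] := finZmod_torsion _ (f P).1.
  (* Subtracting twice a lift of [v] kills the free part, so [x] is torsion. *)
  pose x := P - g (0, v) *+ 2.
  have fx : f x = ((f P).1, 0).
    rewrite /x raddfB raddfMn gK; case: (f P) hv => a b /= ->.
    by rewrite !mulr2n; congr (_, _); rewrite /= ?subrr // addr0 oppr0 addr0.
  have xN : x *+ N = 0.
    apply: (can_inj fK); rewrite raddfMn raddf0 fx -[RHS]/(0, 0) -tN.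
    elim: N {N_gt0 tN} => [|N IH] //.
    by rewrite mulrS IH [in RHS]mulrS; congr (_, _); rewrite /= addr0.
  have [y [t [ex et]]] := torsion_mod_double _ no4 _ _ N_gt0 xN.
  exists P, (g (0, v) + y + t), t; split=> //.
  rewrite -[P](subrK (g (0, v) *+ 2)) -/x ex !mulrnDl et addr0.
  by rewrite addrAC -(addrA _ t t) -mulr2n et addr0 addrC.
case: r r2 f g fK gK => [|[|//]] _ f g fK gK.
  exists P1, 0; split; first by constructor 1.
  by apply/rowP; case.
pose c P : int := (f P).2 0 0.
have even P : ~~ odd `|c P|%N -> exists v, (f P).2 = v *+ 2.
  move=> h; exists (const_mx (c P %/ 2)%Z); apply/rowP=> i.
  rewrite !mxE ord1 -/(c P); lia.
have cD : c (P1 + P2) = c P1 + c P2 by rewrite /c raddfD !mxE.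
case: (boolP (odd `|c P1|%N)) => h1; last first.
  by have [v hv] := even _ h1; exists P1, v; split=> //; constructor 1.
case: (boolP (odd `|c P2|%N)) => h2; last first.
  by have [v hv] := even _ h2; exists P2, v; split=> //; constructor 2.
have [|v hv] := even (P1 + P2); first by rewrite cD; lia.
by exists (P1 + P2), v; split=> //; constructor 3.
Qed.

End Abelian.

(** * Halving points on [C_A] *)

Section CongruentCurve.
Local Open Scope ring_scope.

Lemma two_torsion_coord (A : nat) (A_gt0 : (0 < A)%N)
    (t : ec_point (congruent_curve A A_gt0)) :
  t *+ 2 = 0 ->
  ec_coord t = None \/
  exists2 e, ec_coord t = Some (e, 0) & [\/ e = 0, e = A%:R | e = - A%:R].
Proof.
move=> /(congr1 (@ec_coord _ _)); rewrite mulr2n.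
rewrite -[ec_coord (t + t)]/(ec_add _ (ec_coord t) (ec_coord t)).
case: t => -[[x y]|] /= ot; last by left.
rewrite eqxx /=; case: eqP => // ey _; right.
have y0 : y = 0 by lra.
exists x; first by rewrite y0.
have : x * ((x - A%:R) * (x + A%:R)) = 0.
  have e0 : x ^+ 3 + - A%:R ^+ 2 * x + 0 = 0 by rewrite -(eqP ot) y0 expr0n.
  by rewrite -[RHS]e0; ring.
move/eqP; rewrite !mulf_eq0 subr_eq0 addr_eq0.
by case/or3P=> /eqP; [constructor 1|constructor 2|constructor 3].
Qed.

Lemma double_coord_squares (A : nat) (A_gt0 : (0 < A)%N)
    (Q : ec_point (congruent_curve A A_gt0)) (x y : rat) :
  ec_coord (Q *+ 2) = Some (x, y) ->
  exists b c d : rat, [/\ x = b ^+ 2, x - A%:R = c ^+ 2 & x + A%:R = d ^+ 2].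
Proof.
rewrite mulr2n -[ec_coord (Q + Q)]/(ec_add _ (ec_coord Q) (ec_coord Q)).
case: Q => -[[z w]|] //= oQ; rewrite eqxx /=; case: eqP => // nw [<- _].
have w0 : w != 0 by apply/eqP => w0; apply: nw; rewrite w0 oppr0.
have /eqP := oQ; rewrite /= addr0 mulNr => ew.
rewrite /ec_slope eqxx /=; set a := A%:R in ew *.
have w20 : w ^+ 2 != 0 by rewrite expf_neq0.
have key (B C : rat) : C ^+ 2 = (3 * z ^+ 2 - a ^+ 2) ^+ 2 - (2 * z - B) * (4 * w ^+ 2) ->
    ((3 * z ^+ 2 - a ^+ 2) / (2 * w)) ^+ 2 - z - z + B = (C / (2 * w)) ^+ 2.
  by move=> eC; rewrite [RHS]expr_div_n eC; field.
(* Duplication gives [x = ((z^2 + a^2) / (2w))^2]. Since [w^2 = z^3 - a^2 z], the numbers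
   [(z^2 + a^2)^2 -+ 4 a w^2] are the squares of [z^2 -+ 2 a z - a^2]. The shifts [B] in [key] are
   [0], [-a], [a]. *)
exists ((z ^+ 2 + a ^+ 2) / (2 * w)), ((z ^+ 2 - 2 * a * z - a ^+ 2) / (2 * w)),
  ((z ^+ 2 + 2 * a * z - a ^+ 2) / (2 * w)).
by split; first rewrite -[LHS]addr0; apply: key; rewrite ew; ring.
Qed.

(** If [2 t = (e, 0)], then [e], [e - A], [e + A] are squares. Signs leave only [e = A], where [A]
    and [2 A] are squares, making 2 a rational square. *)
Lemma no_order4 (A : nat) (A_gt0 : (0 < A)%N)
    (t : ec_point (congruent_curve A A_gt0)) :
  t *+ 2 *+ 2 = 0 -> t *+ 2 = 0.
Proof.
have a_gt0 : 0 < A%:R :> rat by rewrite ltr0n.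
case/two_torsion_coord => [h|[e h e_cases]]; first exact: val_inj.
have [b [c [d [eb ec ed]]]] := double_coord_squares _ _ _ _ _ h.
have b2 := sqr_ge0 b; have c2 := sqr_ge0 c.
case: e_cases => ee; rewrite ee in eb ec ed; [exfalso; lra | | exfalso; lra].
have b0 : b != 0 by apply: contraTneq a_gt0 => b0; rewrite eb b0 expr0n ltxx.
have : 2%:R = (d / b) ^+ 2 :> rat.
  by rewrite expr_div_n -ed eb; field.
by case/natr_rat_square => -[|[|s]]; nia.
Qed.

(** For [t = (e, 0)], the abscissa of [P + t] times [(e - x)^2] is [-A^2 x], [A (x^2 - A^2)] or
    [-A (x^2 - A^2)] for [e = 0, A, -A]. As [x > A], only [e = A] lets it be a square. *)
Lemma add_two_torsion_double (A : nat) (A_gt0 : (0 < A)%N)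
    (P R t : ec_point (congruent_curve A A_gt0)) (x y : rat) :
  ec_coord P = Some (x, y) -> A%:R < x -> t *+ 2 = 0 -> P + t = R *+ 2 ->
  (exists c d : rat, x - A%:R = c ^+ 2 /\ x + A%:R = d ^+ 2) \/
  exists b : rat, A%:R * x = b ^+ 2.
Proof.
move=> eP ltx t2 ePt; have a_gt0 : 0 < A%:R :> rat by rewrite ltr0n.
have := ec_coordP P; rewrite eP /= addr0 mulNr => /eqP ey.
have e1 : ec_coord (R *+ 2) = ec_add (congruent_curve A A_gt0) (ec_coord P) (ec_coord t).
  by rewrite -ePt.
case/two_torsion_coord: t2 => [et|[e et ee]]; rewrite et eP in e1.
  have [b [c [d [_ ec ed]]]] := double_coord_squares _ _ _ _ _ e1.
  by left; exists c, d.
have nxe : x != e by case: ee => ->; apply/eqP; lra.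
move: e1; rewrite /= (negPf nxe) /= => /double_coord_squares [b [_ [_ [eb _ _]]]].
have dx : e - x != 0 by rewrite subr_eq0 eq_sym.
rewrite /ec_slope (negPf nxe) in eb.
have eb' : y ^+ 2 - (x + e) * (e - x) ^+ 2 = b ^+ 2 * (e - x) ^+ 2.
  by rewrite -eb; field.
have P1 := sqr_ge0 (b * (e - x)).
have x2 : A%:R ^+ 2 < x ^+ 2 by nra.
clear eP et ePt; rewrite exprMn -eb' ey in P1; case: ee => ee; rewrite ee in P1 eb' dx.
- have ax : 0 < A%:R ^+ 2 * x by rewrite mulr_gt0 ?exprn_gt0 //; lra.
  by exfalso; lra.
(* Multiply [A (x^2 - A^2) = (b (A - x))^2] by [x^2] and divide by [y^2 = x (x^2 - A^2)]. *)
- right; exists (b * (A%:R - x) * x / y).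
  have y20 : y ^+ 2 != 0 by rewrite ey; apply/eqP; nra.
  by rewrite expr_div_n !exprMn -eb'; apply: (mulIf y20); rewrite divfK // ey; ring.
have ax : 0 < A%:R * (x ^+ 2 - A%:R ^+ 2) by rewrite mulr_gt0 // subr_gt0.
by exfalso; lra.
Qed.


(** * Points coming from right triangles *)

Lemma triangle_on_curve (A : nat) (A_gt0 : (0 < A)%N) (u v : rat) :
  A%:R = u * v * (u ^+ 2 - v ^+ 2) ->
  on_curve (congruent_curve A A_gt0)
    (Some (u ^+ 2 * (u ^+ 2 - v ^+ 2), u ^+ 2 * (u ^+ 2 - v ^+ 2) ^+ 2)).
Proof. by move=> eA; apply/eqP; rewrite /= eA; ring. Qed.

(** [x - A], [x + A] and [A x] are [u (u + v)], [u (u - v)] and [u v] times the squares of [u - v],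
    [u + v] and [u (u^2 - v^2)]. *)
Lemma triangle_point_descent (A : nat) (A_gt0 : (0 < A)%N) (u v : nat)
    (P R t : ec_point (congruent_curve A A_gt0)) (y : rat) :
  (0 < v < u)%N -> A%:R = u%:R * v%:R * (u%:R ^+ 2 - v%:R ^+ 2) :> rat ->
  ec_coord P = Some (u%:R ^+ 2 * (u%:R ^+ 2 - v%:R ^+ 2), y) ->
  t *+ 2 = 0 -> P + t = R *+ 2 ->
  (exists s s', u * (u + v) = s ^ 2 /\ u * (u - v) = s' ^ 2)%N \/
  (exists s, u * v = s ^ 2)%N.
Proof.
case/andP=> v_gt0 ltvu eA eP t2 ePt.
have [lt0v ltvu'] : 0 < v%:R :> rat /\ v%:R < u%:R :> rat by rewrite ltr0n ltr_nat.
have d_gt0 : 0 < u%:R ^+ 2 - v%:R ^+ 2 :> rat.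
  by rewrite subr_sqr mulr_gt0 ?subr_gt0 // addr_gt0 //; lra.
have ltx : A%:R < u%:R ^+ 2 * (u%:R ^+ 2 - v%:R ^+ 2) :> rat.
  by rewrite eA ltr_pM2r // ltr_pM2l //; lra.
have pN : u%:R - v%:R != 0 :> rat by apply/eqP; lra.
have pD : u%:R + v%:R != 0 :> rat by apply/eqP; lra.
case: (add_two_torsion_double _ _ _ _ _ _ _ eP ltx t2 ePt) => [[c [d [ec ed]]]|[b eb]].
  left; case: (natr_rat_square (u * (u + v)) (c / (u%:R - v%:R))) => [|s es].
    by rewrite expr_div_n -ec eA natrM natrD; field.
  case: (natr_rat_square (u * (u - v)) (d / (u%:R + v%:R))) => [|s' es'].
    by rewrite expr_div_n -ed eA natrM natrB 1?ltnW //; field.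
  by exists s, s'.
right; apply: (natr_rat_square _ (b / (u%:R * (u%:R ^+ 2 - v%:R ^+ 2)))).
rewrite expr_div_n -eb eA natrM; field.
by rewrite gt_eqF //= gt_eqF //; lra.
Qed.

End CongruentCurve.

(** * Squarefreeness and squares modulo 4 *)

Lemma prod_distinct_primes_square_eq1 (j : nat) (p : 'I_j -> nat) (s : nat) :
  (forall i, prime (p i)) -> injective p ->
  \prod_(i < j) p i = s ^ 2 -> s = 1.
Proof.
move=> p_prime p_inj es.
have s_gt0 : 0 < s.
  by rewrite -(sqrn_gt0 s) -es prodn_gt0 // => i; apply: prime_gt0.
case: j p p_prime p_inj es => [|j] p p_prime p_inj es.
  by rewrite big_ord0 in es; nia.
(* The first prime has exponent one in the product but an even exponent in [s ^ 2]. *)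
have /(congr1 (logn (p ord0))) := es.
set rest := \prod_(i < j.+1 | i != ord0) p i.
have rest_gt0 : 0 < rest by apply: prodn_cond_gt0 => i _; apply: prime_gt0.
have co : coprime (p ord0) rest.
  apply: (big_ind (coprime (p ord0))) => [|a b ca cb|i ne]; first exact: coprimen1.
    by rewrite coprimeMr ca.
  by rewrite prime_coprime // dvdn_prime2 // inj_eq // eq_sym.
rewrite (bigD1 ord0) //= (lognM _ (prime_gt0 (p_prime _)) rest_gt0) lognX logn_prime // eqxx.
by rewrite (logn_coprime co); lia.
Qed.

Lemma sqrn_mod4 (s : nat) : s ^ 2 %% 4 = odd s.
Proof.
rewrite -{1}(odd_double_half s); set h := s./2.
have -> : (odd s + h.*2) ^ 2 = (h ^ 2 + odd s * h) * 4 + odd s.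
  by case: (odd s) => /=; nia.
by rewrite modnMDl; case: (odd s).
Qed.

(** For odd [m], [s^2 - s'^2 = 2 m] would be 2 modulo 4, which no difference of squares is;
    [m < q ^ 2] keeps the truncated subtraction exact. *)
Lemma square_progression_step_even (m q s s' : nat) :
  m < q ^ 2 -> q ^ 2 + m = s ^ 2 -> q ^ 2 - m = s' ^ 2 -> ~~ odd m.
Proof.
have := (sqrn_mod4 q, sqrn_mod4 s, sqrn_mod4 s').
move: (q ^ 2) (s ^ 2) (s' ^ 2) => Q S S' [[]].
by case: (odd q); case: (odd s); case: (odd s'); lia.
Qed.

(** * Descent at each of the three points *)

Theorem mainTheorem1 (m n l : nat)
    (m_gt0 : 0 < m) (n_gt0 : 0 < n) (l_gt0 : 0 < l)
    (coprime_mn : coprime m n) (coprime_ml : coprime m l)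
    (coprime_nl : coprime n l)
    (j : nat) (p : 'I_j -> nat)
    (p_prime : forall i, prime (p i))
    (p_mod6 : forall i, p i = 1 %[mod 6])
    (p_distinct : injective p)
    (m_prod : m = \prod_(i < j) p i)
    (m_sqr : m ^ 2 = n ^ 2 + n * l + l ^ 2) :
  let k := n + l in
  let A := k * l * m * n in
  let C_A := congruent_curve A (klmn_gt0 m_gt0 n_gt0 l_gt0) in
  forall r : nat, has_rank (ec_point C_A) r -> 2 <= r.
Proof.
move=> k A C_A r rank_r; rewrite leqNgt; apply/negP => r_lt2.
have ltnm : n < m by nia.
have ltlm : l < m by nia.
have ltmk : m < k by rewrite /k; nia.
have m_nsq w s : coprime m w -> m * w = s ^ 2 -> False.
  move=> co /(coprime_mul_square _ _ _ co) [t et].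
  have t1 : t = 1.
    by apply: (prod_distinct_primes_square_eq1 _ _ _ p_prime p_distinct); rewrite -m_prod.
  by rewrite et t1 in ltnm; lia.
have co_km : coprime k m.
  have : coprime (k ^ 2) (m ^ 2).
    have -> : k ^ 2 = n * l + m ^ 2 by rewrite m_sqr /k; lia.
    by rewrite coprime_sym /coprime gcdnDr -/(coprime _ _) coprimeXl // coprimeMr coprime_mn.
  by rewrite coprime_pexpl // coprime_pexpr.
(* [n] and [l] are not both even, and then [n^2 + n l + l^2] is odd. *)
have odd_m : odd m.
  have : ~~ (~~ odd n && ~~ odd l).
    apply/negP => /andP[en el].
    have : 2 %| gcdn n l by rewrite dvdn_gcd !dvdn2 en.
    by rewrite (eqP coprime_nl).
  by have := congr1 odd m_sqr; rewrite !oddD !oddX oddM /=; case: (odd m); case: (odd n); case: (odd l).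
have eM : (m%:R ^+ 2 = n%:R ^+ 2 + n%:R * l%:R + l%:R ^+ 2 :> rat)%R.
  by rewrite -!natrX -natrM -!natrD m_sqr.
have eK : (k%:R = n%:R + l%:R :> rat)%R by rewrite natrD.
have eA1 : (A%:R = m%:R * n%:R * (m%:R ^+ 2 - n%:R ^+ 2) :> rat)%R.
  by rewrite !natrM eK; ring: eM.
have eA2 : (A%:R = m%:R * l%:R * (m%:R ^+ 2 - l%:R ^+ 2) :> rat)%R.
  by rewrite !natrM eK; ring: eM.
have eA3 : (A%:R = k%:R * m%:R * (k%:R ^+ 2 - m%:R ^+ 2) :> rat)%R.
  by rewrite !natrM eK; ring: eM.
have o1 := triangle_on_curve A (klmn_gt0 m_gt0 n_gt0 l_gt0) _ _ eA1.
have o2 := triangle_on_curve A (klmn_gt0 m_gt0 n_gt0 l_gt0) _ _ eA2.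
have [P [R [t [P_cases t2 ePt]]]] :=
  rank_lt2_dependent _ _ rank_r r_lt2 (@no_order4 _ _) (EcPoint o1) (EcPoint o2).
case: P_cases => eP.
- have eP' := congr1 (@ec_coord _ _) eP.
  have rng : 0 < n < m by rewrite n_gt0.
  case: (triangle_point_descent _ _ _ _ _ _ _ _ rng eA1 eP' t2 ePt) =>
    [[s [s' [es _]]]|[s es]]; last exact: m_nsq es.
  by apply: m_nsq es; rewrite /coprime gcdnDl.
- have eP' := congr1 (@ec_coord _ _) eP.
  have rng : 0 < l < m by rewrite l_gt0.
  case: (triangle_point_descent _ _ _ _ _ _ _ _ rng eA2 eP' t2 ePt) =>
    [[s [s' [es _]]]|[s es]]; last exact: m_nsq es.
  by apply: m_nsq es; rewrite /coprime gcdnDl.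
(* The descent at [P1 + P2] reads only the abscissa, which is that of the pair [(k, m)], so the
   ordinate is left unspecified. *)
have [y eP'] : exists y,
    ec_coord P = Some ((k%:R ^+ 2 * (k%:R ^+ 2 - m%:R ^+ 2))%R, y).
  have hs : (slope_of C_A (m%:R ^+ 2 * (m%:R ^+ 2 - n%:R ^+ 2))
      (m%:R ^+ 2 * (m%:R ^+ 2 - n%:R ^+ 2) ^+ 2)
      (m%:R ^+ 2 * (m%:R ^+ 2 - l%:R ^+ 2))
      (m%:R ^+ 2 * (m%:R ^+ 2 - l%:R ^+ 2) ^+ 2) (k%:R ^+ 2))%R.
    by split; rewrite /= ?eA1 eK; ring: eM.
  (* Both ordinates are positive, so the two points are not opposite and the addition formula with
     slope [k^2] applies. *)
  have pos v : v < m -> (0 < m%:R ^+ 2 * (m%:R ^+ 2 - v%:R ^+ 2) ^+ 2 :> rat)%R.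
    move=> ltvm; rewrite mulr_gt0 ?exprn_gt0 ?ltr0n // subr_gt0.
    by rewrite -!natrX ltr_nat ltn_sqr.
  eexists; rewrite eP -[LHS]/(ec_add C_A _ _) (ec_add_slope o1 o2 _ hs).
    by rewrite /sum_with; congr (Some (_, _)); rewrite eK; ring: eM.
  by rewrite negb_and -addr_eq0 [X in _ || ~~ X]gt_eqF ?orbT // addr_gt0 ?pos.
have rng : 0 < m < k by rewrite m_gt0.
case: (triangle_point_descent _ _ _ _ _ _ _ _ rng eA3 eP' t2 ePt) =>
  [[s [s' [es es']]]|[s es]].
- have co1 : coprime k (k + m) by rewrite /coprime gcdnDl.
  have co2 : coprime k (k - m).
    rewrite coprime_sym -{2}(subnK (ltnW ltmk)) /coprime gcdnDl gcdnC -gcdnDr.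
    by rewrite (subnK (ltnW ltmk)) gcdnC.
  have [q eq] := coprime_mul_square _ _ _ co1 es.
  have [a ea] : exists a, k + m = a ^ 2.
    by apply: (coprime_mul_square _ k s); rewrite 1?coprime_sym // mulnC.
  have [b eb] : exists b, k - m = b ^ 2.
    by apply: (coprime_mul_square _ k s'); rewrite 1?coprime_sym // mulnC.
  rewrite eq in ltmk ea eb.
  by have := square_progression_step_even _ _ _ _ ltmk ea eb; rewrite odd_m.
by apply: (m_nsq k s); rewrite 1?coprime_sym // mulnC.
Qed.
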